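(* Let $\mathfrak{M}=(\mathbf{M},\models,\mathcal{P}(\mathscr{L}))$ be a normal abstract model structure, $\tau_N$ the topology on $\mathbf{M}$ generated by the subbase $\{\mathbf{M}\setminus\mathsf{Mod}(\{\alpha\})\mid\alpha\in\mathscr{L}\}$, and $\tau_C$ the topology on $\mathbf{M}$ generated by the base $\{\mathsf{Mod}(\Gamma)\mid\Gamma\subseteq\mathscr{L}\}$. Let $(m_i)_{i\in I}$ be a family in $\mathbf{M}$, $\mathcal{U}$ an ultrafilter on $I$ and $\mathsf{u}\in\mathbf{M}$. Then $\mathsf{u}$ is a $\mathcal{U}$-ultralimit of $(m_i)_{i\in I}$ in both $(\mathbf{M},\tau_N)$ and $(\mathbf{M},\tau_C)$ iff for all $\Sigma\subseteq\mathscr{L}$: $\mathsf{u}\models\Sigma$ iff $\{i\in I\mid m_i\models\Sigma\}\in\mathcal{U}$.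
   Context: An abstract model structure is a triple $(\mathbf{M},\models,\mathcal{P}(\mathscr{L}))$ with $\mathbf{M}\neq\emptyset$, $\mathscr{L}$ a set and $\models\,\subseteq\mathbf{M}\times\mathcal{P}(\mathscr{L})$. It is normal if for all $m$ and $\Gamma$: $m\models\Gamma$ iff $m\models\{\alpha\}$ for all $\alpha\in\Gamma$. $\mathsf{Mod}(\Gamma)=\{m\in\mathbf{M}\mid m\models\Gamma\}$. For a topological space $(X,\tau)$, a family $(x_i)_{i\in I}$ and an ultrafilter $\mathcal{U}$ on $I$, $x\in X$ is a $\mathcal{U}$-ultralimit of $(x_i)$ if for every $\tau$-open $U\ni x$, $\{i\in I\mid x_i\in U\}\in\mathcal{U}$. *)

(* Defs.v *)
From HB Require Import structures.
From mathcomp Require Import all_boot all_classical topology.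

Set Implicit Arguments.
Unset Strict Implicit.
Unset Printing Implicit Defensive.

Local Open Scope classical_set_scope.

Record abstract_model_structure := AbstractModelStructure {
  model :> Type;
  language : Type;
  sat : model -> set language -> Prop;
  model_neq0 : [set: model] !=set0
}.

Definition Mod (M : abstract_model_structure) (Gamma : set (language M)) :
  set M := [set m | sat m Gamma].

Definition normal (M : abstract_model_structure) : Prop :=
  forall (m : M) (Gamma : set (language M)),
    sat m Gamma <-> (forall alpha, Gamma alpha -> sat m [set alpha]).

(* [tauN M] and [tauC normM] are copies of the carrier of [M], to be equipped
   with two different topologies; [{classic _}] supplies the choiceType
   structure that [topologicalType] requires. *)
Definition tauN (M : abstract_model_structure) : Type := {classic M}.

HB.instance Definition _ M := Choice.on (tauN M).

(* Bases and subbases are indexed by themselves, because the factories require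
   pointed index types and [language M] may be empty. *)
HB.instance Definition _ (M : abstract_model_structure) :=
  isSubBaseTopological.Build (tauN M)
    [set ~` Mod [set alpha] | alpha in [set: language M]] id.

(* The sets [Mod Gamma] are a base only when [M] is normal, hence the second
   parameter. *)
Definition tauC (M : abstract_model_structure) (normM : normal M) : Type :=
  {classic M}.

Section ModBase.
Variables (M : abstract_model_structure) (normM : normal M).

HB.instance Definition _ := Choice.on (tauC normM).

Definition Mods : set (set (tauC normM)) :=
  [set Mod Gamma | Gamma in [set: set (language M)]].

Lemma Mods_cover : \bigcup_(A in Mods) id A = [set: tauC normM].
Proof.
rewrite -subTset => m _; exists (Mod set0); first by exists set0.
by apply/normM.
Qed.

Lemma Mods_join (A B : set (tauC normM)) (m : tauC normM) :
  Mods A -> Mods B -> id A m -> id B m ->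
  exists C, [/\ Mods C, id C m & id C `<=` id A `&` id B].
Proof.
move=> [Gamma _ <-] [Delta _ <-] mG mD; exists (Mod (Gamma `|` Delta)); split.
- by exists (Gamma `|` Delta).
- apply/normM => alpha [Ga|Da].
    by have /normM := mG; exact.
  by have /normM := mD; exact.
- move=> n /normM nGD.
  by split; apply/normM => alpha ?; apply: nGD; [left|right].
Qed.

HB.instance Definition _ :=
  isBaseTopological.Build (tauC normM) Mods_cover Mods_join.

End ModBase.

Definition ultralimit (X : topologicalType) (I : Type) (U : set_system I)
    (x : I -> X) (l : X) : Prop :=
  forall V : set X, open V -> V l -> U [set i | V (x i)].

(* Main.v *)
(* Convergence need only be tested on a (sub)base: a tau_C-ultralimit transfers
   satisfaction of every [Sigma] from [u] to [U]-many [m i], a tau_N-ultralimit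
   transfers failure of single sentences. By normality, failure of [Sigma] is
   failure of some sentence of [Sigma], which gives the converse transfer. *)

Require Import Defs.
From mathcomp Require Import all_boot finmap all_classical topology.

Local Open Scope classical_set_scope.

(** True by conversion; it exposes opens as unions of finite intersections for rewriting. *)
Lemma open_tauNE (M : abstract_model_structure) :
  @open (tauN M) =
  [set \bigcup_(B in D) B | D in subset^~
    (finI_from [set ~` Mod [set alpha] | alpha in [set: language M]] id)].
Proof. by []. Qed.

Lemma open_tauCE (M : abstract_model_structure) (normM : normal M) :
  @open (tauC normM) = [set \bigcup_(B in D) B | D in subset^~ (@Mods M normM)].
Proof. by []. Qed.

(** Testing the subbase suffices because a filter is closed under finite intersections and
    supersets. *)
Lemma ultralimit_tauN (M : abstract_model_structure) (I : Type) (m : I -> M)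
    (U : set_system I) (FU : Filter U) (u : M) :
  @ultralimit (tauN M) I U m u <->
  forall alpha, ~ sat u [set alpha] -> U [set i | ~ sat (m i) [set alpha]].
Proof.
rewrite /ultralimit open_tauNE.
split=> [limu alpha nu|subbase V [D subD <-] [B DB Bu]].
  apply: (limu (~` Mod [set alpha])) nu.
  exists [set ~` Mod [set alpha]]; last by rewrite bigcup_set1.
  by move=> _ ->; exact: (finI_from1 id (imageT _ alpha)).
have [E subE EB] := subD _ DB.
have UE A : A \in E -> U (m @^-1` A).
  move=> AE; have /set_mem[alpha _ alphaA] := subE _ AE.
  have : A u by move: Bu; rewrite -EB; exact.
  by rewrite -alphaA; exact: subbase.
by apply: filterS _ (filter_bigI _ UE) => i Ei; exists B; rewrite // -EB.
Qed.

(** With a base, closure of [U] under supersets suffices. *)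
Lemma ultralimit_tauC (M : abstract_model_structure) (normM : normal M)
    (I : Type) (m : I -> M) (U : set_system I) (FU : Filter U) (u : M) :
  @ultralimit (tauC normM) I U m u <->
  forall Gamma, sat u Gamma -> U [set i | sat (m i) Gamma].
Proof.
rewrite /ultralimit open_tauCE.
split=> [limu Gamma|base V [D subD <-] [B DB Bu]].
  apply: (limu (Mod Gamma)).
  exists [set Mod Gamma]; last by rewrite bigcup_set1.
  by move=> _ ->; exists Gamma.
have [Gamma _ GammaB] := subD _ DB.
have uGamma : sat u Gamma by move: Bu; rewrite -GammaB.
by apply: filterS _ (base _ uGamma) => i mi; exists B; rewrite // -GammaB.
Qed.

Theorem theorem3p42 (M : abstract_model_structure) (normM : normal M)
    (I : Type) (m : I -> M) (U : set_system I) (ultraU : UltraFilter U)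
    (u : M) :
  (@ultralimit (tauN M) I U m u /\ @ultralimit (tauC normM) I U m u) <->
  (forall Sigma : set (language M),
     sat u Sigma <-> U [set i | sat (m i) Sigma]).
Proof.
rewrite ultralimit_tauN ultralimit_tauC; split=> [[limN limC] Sigma|satU].
  split=> [/limC //|USigma]; apply/normM => alpha Sigma_alpha.
  (* Otherwise, as [U] is proper, some [m i] satisfies [Sigma] but not [alpha]. *)
  apply: contrapT => /limN Unalpha.
  have [i [/= /normM mi]] := filter_ex (filterI USigma Unalpha).
  by apply; exact: mi.
split=> [alpha|Gamma /satU //].
(* [U] contains this set or its complement; the former would make [u] satisfy [alpha]. *)
by have [|//] := in_ultra_setVsetC [set i | sat (m i) [set alpha]] ultraU;
  move=> /satU.
Qed.
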